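(* Let $p$ be a prime and suppose there exists $A\subseteq\mathbb{F}_p$ with $A-A\doteq\mathcal{R}_p$; write $p=2n(n-1)+1$ (with $n=|A|$). Then neither $n$ nor $n-1$ has a prime divisor congruent to $7$ modulo $8$. Moreover, of the two numbers $n$ and $n-1$, the odd one has no prime divisor congruent to $5$ modulo $8$, and the even one has no prime divisor congruent to $3$ modulo $8$.
   Context: $\mathcal{R}_p$ is the set of nonzero quadratic residues modulo $p$. $A-A\doteq S$ means: every element of $S$ has exactly one representation as $a'-a''$ with $a',a''\in A$, and every difference $a'-a''$ with $a'\ne a''$ in $A$ lies in $S$. *)

(* Defs.v *)
From mathcomp Require Import all_boot all_order all_algebra.
Set Implicit Arguments. Unset Strict Implicit. Unset Printing Implicit Defensive.
Import GRing.Theory.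
Local Open Scope ring_scope.

Definition qres (p : nat) : {set 'F_p} :=
  [set x : 'F_p | (x != 0) && [exists y : 'F_p, y * y == x]].

Definition perfect_diff (p : nat) (A S : {set 'F_p}) : Prop :=
  (forall s, s \in S ->
     #|[set u in setX A A | u.1 - u.2 == s]| = 1%N) /\
  (forall a1 a2, a1 \in A -> a2 \in A -> a1 != a2 -> a1 - a2 \in S).

(* Main.v *)
Require Import Defs.
From mathcomp Require Import all_boot all_order all_algebra.
From mathcomp Require Import all_solvable all_field.
From mathcomp Require Import ring zify.

(* Let m = n(n-1)/2, so that p = 4m + 1 = n^2 + (n-1)^2.

   First, if a prime q divides m, then -1 is not a power of q modulo p, that
   is, q has odd order modulo p. This is seen on the transform of A with
   values in a field of characteristic q containing a primitive p-th root of
   unity. If m were even, 2 would have odd order too, hence so would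
   p - 1 = -1, which is absurd. Thus m is odd, and q^m = 1 modulo p.

   For m odd, let theta0 + i theta1 be the quartic Gauss sum and s the quadratic
   one. Then s^2 = p, theta0^2 + theta1^2 = -p, theta0^2 - theta1^2 = d s and
   theta0 theta1 = c s with integers c, d such that p = d^2 + (2c)^2; by
   uniqueness |d| and |2c| are the odd and the even one of n, n-1. In
   characteristic q, q^m = 1 makes theta0, theta1 and s fixed by Frobenius. If
   q divides c, some theta_j / s is a square root of -1 in the prime field, so
   q = 1 mod 4. If q divides d, then s / theta0 is a square root of -2 in the
   prime field, so q = 1 or 3 mod 8. *)

Set Implicit Arguments.
Unset Strict Implicit.
Unset Printing Implicit Defensive.
Import Order.TTheory GRing.Theory Num.Theory.
Local Open Scope ring_scope.

(** * Fermat's theorem and primitive roots modulo p *)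

Lemma Fp_fermat (p : nat) (x : 'F_p) : prime p -> x != 0 -> x ^+ p.-1 = 1.
Proof.
move=> pr_p x_neq0; apply/(mulfI x_neq0).
rewrite -exprS mulr1 (prednK (prime_gt0 pr_p)).
by have := expf_card x; rewrite (card_Fp pr_p).
Qed.

Lemma Fp_primitive_root (p : nat) :
  prime p -> exists g : 'F_p, p.-1.-primitive_root g.
Proof.
move=> pr_p; have p_gt1 := prime_gt1 pr_p.
have : has p.-1.-primitive_root (enum [pred x : 'F_p | x != 0]).
  apply: has_prim_root; first lia.
  - apply/allP => x; rewrite mem_enum inE => x_neq0; rewrite unity_rootE.
    by rewrite Fp_fermat.
  - exact: enum_uniq.
  - by rewrite -cardE (cardC1 0) card_Fp.
by move=> /hasP [g _ prim_g]; exists g.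
Qed.

(** * Fourier transform on F_p *)

Section FourierTransform.

Variables (p : nat) (K : fieldType) (z : K).
Hypotheses (pr_p : prime p) (prim_z : p.-primitive_root z).

Definition addch (x : 'F_p) : K := z ^+ x.

(** Functions are integer valued, so that one convolution identity serves over fields [K] of every
    characteristic. *)
Definition dft (f : 'F_p -> int) (u : 'F_p) : K :=
  \sum_x (f x)%:~R * addch (u * x).

Definition conv (f g : 'F_p -> int) (t : 'F_p) : int :=
  \sum_x f x * g (t - x).

Lemma addchD x y : addch (x + y) = addch x * addch y.
Proof.
rewrite /addch -exprD -[RHS](prim_expr_mod prim_z); congr (_ ^+ _).
have : nat_of_ord (x + y) = ((x + y) %% (Zp_trunc (pdiv p)).+2)%N by [].
by move=> ->; move: (x + y)%N => k; rewrite Fp_cast.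
Qed.

Lemma addch0 : addch 0 = 1.
Proof. exact: expr0. Qed.

Lemma addchX x n : addch x ^+ n = addch (x * n%:R).
Proof.
elim: n => [|n IHn]; first by rewrite mulr0 addch0.
by rewrite exprSr IHn -addn1 natrD mulrDr mulr1 addchD.
Qed.

Lemma sum_addch : \sum_x addch x = 0.
Proof.
have shift : (\sum_x addch x) * addch 1 = \sum_x addch x.
  rewrite mulr_suml [RHS](reindex_inj (addIr (1 : 'F_p))).
  by apply: eq_bigr => x _; rewrite addchD.
have addch1_neq1 : addch 1 != 1.
  rewrite /addch expr1 -[z]expr1 -(prim_order_dvd prim_z) dvdn1.
  by rewrite neq_ltn prime_gt1 ?orbT.
apply/eqP; move/eqP: shift; rewrite -subr_eq0 -{2}[\sum_x _]mulr1 -mulrBr.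
by rewrite mulf_eq0 subr_eq0 (negPf addch1_neq1) orbF.
Qed.

Lemma sum_addch_mul u : u != 0 -> \sum_x addch (u * x) = 0.
Proof.
by move=> u_neq0; have := sum_addch; rewrite (reindex_inj (mulfI u_neq0)).
Qed.

(** In characteristic p, Frobenius would send z - 1 to z^p - 1 = 0, forcing z = 1. *)
Lemma natr_p_neq0 : p%:R != 0 :> K.
Proof.
apply/negP => /eqP p0.
have pK : p \in [pchar K] by rewrite inE pr_p p0 eqxx.
have : pFrobenius_aut pK (z - 1) = 0.
  rewrite rmorphB rmorph1 /= pFrobenius_autE (prim_expr_order prim_z).
  by rewrite subrr.
move/eqP; rewrite fmorph_eq0 subr_eq0 => /eqP z1.
have := prim_order_dvd prim_z 1; rewrite z1 expr1 eqxx dvdn1 => /eqP p1.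
by move: pr_p; rewrite p1.
Qed.

Lemma eq_dft f g : f =1 g -> dft f =1 dft g.
Proof. by move=> fg u; apply: eq_bigr => x _; rewrite fg. Qed.

Lemma dftD f g u : dft f u + dft g u = dft (fun x => f x + g x) u.
Proof.
by rewrite -big_split; apply: eq_bigr => x _ /=; rewrite rmorphD mulrDl.
Qed.

Lemma dftB f g u : dft f u - dft g u = dft (fun x => f x - g x) u.
Proof.
by rewrite -sumrB; apply: eq_bigr => x _ /=; rewrite rmorphB mulrBl.
Qed.

Lemma dftZ (c : int) f u : dft (fun x => c * f x) u = c%:~R * dft f u.
Proof.
by rewrite mulr_sumr; apply: eq_bigr => x _ /=; rewrite intrM mulrA.
Qed.

Lemma dftM f g u : dft f u * dft g u = dft (conv f g) u.
Proof.
rewrite /dft mulr_suml.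
under eq_bigr do rewrite mulr_sumr.
under [RHS]eq_bigr do rewrite rmorph_sum mulr_suml /=.
rewrite [RHS]exchange_big; apply: eq_bigr => x _.
rewrite [RHS](reindex_inj (addIr x)); apply: eq_bigr => y _ /=.
by rewrite addrK intrM mulrDr addchD; ring.
Qed.

Lemma dft_scale f u t : t != 0 -> dft f (u * t) = dft (fun x => f (x / t)) u.
Proof.
move=> t_neq0; rewrite [RHS](reindex_inj (mulfI t_neq0)).
by apply: eq_bigr => x _ /=; rewrite [u * (t * x)]mulrA [t * x]mulrC mulfK.
Qed.

(** Subtracting the constant [f 1], whose transform vanishes at u <> 0, leaves a point mass at 0. *)
Lemma dft_invariant f u :
  (forall t, t != 0 -> f t = f 1) -> u != 0 -> dft f u = (f 0 - f 1)%:~R.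
Proof.
move=> f_inv u_neq0.
have sum_neq0 : \sum_(x | x != 0) addch (u * x) = -1.
  apply/eqP; rewrite -addr_eq0 addrC; apply/eqP.
  by have := sum_addch_mul u_neq0; rewrite (bigD1 0) //= mulr0 addch0.
rewrite /dft (bigD1 0) //= mulr0 addch0 mulr1.
under eq_bigr => x x_neq0 do rewrite f_inv //.
by rewrite -mulr_sumr sum_neq0 mulrN1 rmorphB.
Qed.

(** Frobenius fixes the integer coefficients and multiplies the exponents of z by q. *)
Lemma dft_pchar (q : nat) f u :
  q \in [pchar K] -> dft f u ^+ q = dft f (u * q%:R).
Proof.
move=> qK; rewrite -(pFrobenius_autE qK) rmorph_sum; apply: eq_bigr => x _.
rewrite rmorphM rmorph_int; congr (_ * _).
by rewrite /= pFrobenius_autE addchX mulrAC.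
Qed.

Lemma dft_pcharX (q j : nat) f u :
  q \in [pchar K] -> dft f u ^+ (q ^ j) = dft f (u * q%:R ^+ j).
Proof.
move=> qK; elim: j => [|j IHj]; first by rewrite !expr0 mulr1.
by rewrite expnSr exprM IHj dft_pchar // -mulrA -exprSr.
Qed.

Lemma dft_inversion f (x : 'F_p) :
  \sum_u dft f u * addch (- (u * x)) = p%:R * (f x)%:~R.
Proof.
under eq_bigr do rewrite mulr_suml.
rewrite exchange_big (bigD1 x) //= [X in _ + X]big1 => [|y y_neq_x].
  under eq_bigr do rewrite -mulrA -addchD subrr addch0 mulr1.
  by rewrite sumr_const card_Fp // addr0 mulr_natl.
under eq_bigr do rewrite -mulrA -addchD -mulrBr mulrC [_ * (y - x)]mulrC.
by rewrite -mulr_suml sum_addch_mul ?mul0r // subr_eq0.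
Qed.

Lemma sum_conv f g : \sum_t conv f g t = (\sum_x f x) * \sum_x g x.
Proof.
rewrite exchange_big mulr_suml; apply: eq_bigr => x _ /=.
by rewrite -mulr_sumr (reindex_inj (addIr x)); under eq_bigr do rewrite addrK.
Qed.

End FourierTransform.

Lemma Fp_neq1N1 (p : nat) : prime p -> (2 < p)%N -> (1 : 'F_p) != -1.
Proof.
move=> pr_p p_gt2; rewrite -addr_eq0 -(natrD _ 1 1).
rewrite -(dvdn_pcharf (pchar_Fp pr_p)).
by apply/negP => /dvdn_leq; lia.
Qed.

(** * Quadratic periods *)

Section QuadraticPeriods.

Variables (p m : nat).
Hypotheses (pr_p : prime p) (pE : p = (4 * m).+1).

Local Notation F := 'F_p.

Lemma quarter_gt0 : (0 < m)%N.
Proof. by have := prime_gt1 pr_p; lia. Qed.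

Lemma predpE : p.-1 = (4 * m)%N.
Proof. by rewrite pE. Qed.

Lemma expf_Fp (x : F) : x != 0 -> x ^+ (4 * m) = 1.
Proof. by move=> x_neq0; rewrite -predpE Fp_fermat. Qed.

Lemma one_neqN1 : (1 : F) != -1.
Proof. by apply: Fp_neq1N1 => //; have := quarter_gt0; lia. Qed.

Lemma euler_criterion (x : F) : (x \in qres p) = (x ^+ (2 * m) == 1).
Proof.
have m_gt0 := quarter_gt0; rewrite inE; apply/andP/eqP => [[x_neq0]|x2m].
  move=> /existsP [y /eqP yyx]; rewrite -yyx -expr2 -exprM.
  rewrite [(2 * (2 * m))%N](_ : _ = 4 * m)%N ?expf_Fp //; last lia.
  by apply: contra_neq x_neq0 => y0; rewrite -yyx y0 mulr0.
have x_neq0 : x != 0.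
  by apply: contra_eq_neq x2m => ->; rewrite expr0n muln_eq0 (gtn_eqF m_gt0).
split=> //; have [g prim_g] := Fp_primitive_root pr_p.
have xp1 := Fp_fermat pr_p x_neq0.
have [[k /= _] xE] := prim_rootP prim_g xp1.
(* With x = g^k, the number 4m divides 2mk, so k is even and g^(k/2) is a square root of x. *)
have : (p.-1 %| k * (2 * m))%N.
  by rewrite (prim_order_dvd prim_g) exprM -xE x2m.
have -> : (p.-1 = 2 * (2 * m))%N by lia.
rewrite dvdn_pmul2r; last lia.
case/dvdnP => l lE; apply/existsP; exists (g ^+ l).
by rewrite xE lE exprM expr2.
Qed.

Lemma expf_half (x : F) :
  x != 0 -> x ^+ (2 * m) = 1 \/ x ^+ (2 * m) = -1.
Proof.
move=> x_neq0; have : (x ^+ (2 * m)) ^+ 2 = 1.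
  by rewrite -exprM -(expf_Fp x_neq0); congr (_ ^+ _); lia.
by move/eqP; rewrite sqrf_eq1 => /orP [] /eqP; [left|right].
Qed.

Lemma exists_nonresidue : exists2 g : F, g != 0 & g ^+ (2 * m) = -1.
Proof.
have m_gt0 := quarter_gt0; have [g prim_g] := Fp_primitive_root pr_p.
have g_neq0 : g != 0 by rewrite (prim_root_eq0 prim_g) predpE; lia.
exists g => //; case: (expf_half g_neq0) => // /eqP.
rewrite -(prim_order_dvd prim_g) => /dvdn_leq le_dvd; move: m_gt0 le_dvd; lia.
Qed.

(** Stated through Euler's criterion, so that both indicators vanish at 0 and their behaviour under
    scaling is immediate. *)
Definition residue (x : F) : int := (x ^+ (2 * m) == 1)%:R.
Definition nonresidue (x : F) : int := (x ^+ (2 * m) == -1)%:R.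

Lemma residueM (t x : F) : t ^+ (2 * m) = 1 -> residue (t * x) = residue x.
Proof. by move=> t1; rewrite /residue exprMn t1 mul1r. Qed.

Lemma nonresidueM (t x : F) :
  t ^+ (2 * m) = 1 -> nonresidue (t * x) = nonresidue x.
Proof. by move=> t1; rewrite /nonresidue exprMn t1 mul1r. Qed.

Lemma residueMN (t x : F) : t ^+ (2 * m) = -1 -> residue (t * x) = nonresidue x.
Proof. by move=> t1; rewrite /residue exprMn t1 mulN1r eqr_oppLR. Qed.

Lemma nonresidueMN (t x : F) :
  t ^+ (2 * m) = -1 -> nonresidue (t * x) = residue x.
Proof. by move=> t1; rewrite /nonresidue exprMn t1 mulN1r eqr_opp. Qed.

Lemma residue0 : residue 0 = 0.
Proof.
rewrite /residue expr0n; rewrite muln_eq0 /= (gtn_eqF quarter_gt0).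
by rewrite eq_sym oner_eq0.
Qed.

Lemma nonresidue0 : nonresidue 0 = 0.
Proof.
rewrite /nonresidue expr0n; rewrite muln_eq0 /= (gtn_eqF quarter_gt0).
by rewrite eq_sym oppr_eq0 oner_eq0.
Qed.

Lemma residue_add (x : F) : x != 0 -> residue x + nonresidue x = 1.
Proof.
rewrite /residue /nonresidue => /expf_half [] ->; rewrite eqxx.
  by rewrite (negPf one_neqN1).
by rewrite eq_sym (negPf one_neqN1).
Qed.

Lemma expN1_half : (-1 : F) ^+ (2 * m) = 1.
Proof. by rewrite exprM sqrrN !expr1n. Qed.

Lemma sum_residue : \sum_x residue x = (2 * m)%:R.
Proof.
have sumE : \sum_x residue x = \sum_x nonresidue x.
  have [g g_neq0 g1] := exists_nonresidue.
  rewrite (reindex_inj (mulfI g_neq0)).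
  by apply: eq_bigr => x _; rewrite residueMN.
suff : \sum_x residue x + \sum_x nonresidue x = (4 * m)%:R by rewrite -sumE; lia.
rewrite -big_split (bigD1 0) //= residue0 nonresidue0 !add0r.
under eq_bigr => x x_neq0 do rewrite residue_add //.
by rewrite sumr_const (cardC1 0) card_Fp // predpE.
Qed.

Lemma sum_nonresidue : \sum_x nonresidue x = (2 * m)%:R.
Proof.
have [g g_neq0 g1] := exists_nonresidue.
rewrite (reindex_inj (mulfI g_neq0)) -sum_residue.
by apply: eq_bigr => x _; rewrite nonresidueMN.
Qed.

Variables (K : fieldType) (z : K).
Hypothesis prim_z : p.-primitive_root z.

Local Notation dft := (dft z).

Lemma periods_add u : u != 0 -> dft residue u + dft nonresidue u = -1.
Proof.
move=> u_neq0; rewrite dftD (dft_invariant pr_p prim_z _ u_neq0) => [|t t_neq0].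
  by rewrite residue0 nonresidue0 residue_add ?oner_neq0 //.
by rewrite !residue_add ?oner_neq0.
Qed.

(** The convolution [h] counts sums of a residue and a nonresidue. It is 0 at 0, because -1 is a
    residue, and constant elsewhere; its total (2m)^2 spread over 4m elements gives the value m. *)
Lemma periods_mul u : u != 0 -> dft residue u * dft nonresidue u = - m%:R.
Proof.
move=> u_neq0; pose h := conv residue nonresidue.
have h_inv t : t != 0 -> h t = h 1.
  move=> t_neq0; rewrite /h /conv (reindex_inj (mulfI t_neq0)).
  under eq_bigr => x _ do rewrite -{2}[t]mulr1 -mulrBr.
  have [t1|t1] := expf_half t_neq0.
    by apply: eq_bigr => x _; rewrite residueM // nonresidueM.
  (* Scaling by a nonresidue exchanges the two indicators; x -> 1 - x exchanges them back. *)
  rewrite [RHS](reindex_inj (subrI (1 : F))).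
  apply: eq_bigr => x _; rewrite residueMN // nonresidueMN //.
  by rewrite subKr mulrC.
have h0 : h 0 = 0.
  rewrite /h /conv big1 // => x _; rewrite sub0r -mulN1r nonresidueM ?expN1_half //.
  rewrite /residue /nonresidue; case: eqP => [->|_]; last by rewrite mul0r.
  by rewrite (negPf one_neqN1) mulr0.
have h1 : h 1 = m%:R.
  have : \sum_t h t = (2 * m)%:R * (2 * m)%:R.
    by rewrite /h sum_conv // sum_residue sum_nonresidue.
  rewrite (bigD1 0) //= h0 add0r.
  under eq_bigr => x x_neq0 do rewrite h_inv //.
  rewrite sumr_const (cardC1 0) card_Fp // predpE /= => hE.
  have := quarter_gt0; nia.
rewrite (dftM pr_p prim_z) (dft_invariant pr_p prim_z h_inv u_neq0) -/h h0 h1.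
by rewrite sub0r rmorphN /= rmorph_nat.
Qed.

End QuadraticPeriods.

(** * Perfect difference sets *)

Lemma exists_prim_root_pchar (p q : nat) :
  prime p -> prime q -> p != q ->
  exists (K : closedFieldType) (z : K),
    q \in [pchar K] /\ p.-primitive_root z.
Proof.
move=> pr_p pr_q p_neq_q; have p_gt1 := prime_gt1 pr_p.
have [K [toK _]] := countable_algebraic_closure 'F_q.
have qK : q \in [pchar K] := rmorph_pchar toK (pchar_Fp pr_q).
(* A root z of 1 + X + ... + X^(p-1) satisfies z^p = 1, and z = 1 would make p vanish in
   characteristic q. *)
pose f : {poly K} := \poly_(i < p) 1.
have /closed_rootP [z /rootP fz0] : size f != 1%N.
  by rewrite size_poly_eq ?oner_neq0 //; apply/eqP; lia.
have sum_z : \sum_(i < p) z ^+ i = 0.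
  by rewrite -[RHS]fz0 horner_poly; apply: eq_bigr => i _; rewrite mul1r.
have zp1 : z ^+ p = 1.
  by apply/eqP; rewrite -subr_eq0 subrX1 sum_z mulr0.
exists K, z; split=> //.
have [k prim_z k_dvd] := prim_order_exists (prime_gt0 pr_p) zp1.
have /primeP [_ /(_ _ k_dvd) /orP [] /eqP kE] := pr_p; last by rewrite -kE.
have z1 : z = 1 by rewrite -(prim_expr_order prim_z) kE expr1.
move: sum_z; rewrite z1; under eq_bigr do rewrite expr1n.
move/eqP; rewrite sumr_const card_ord -(dvdn_pcharf qK) dvdn_prime2 // eq_sym.
by rewrite (negPf p_neq_q).
Qed.

Definition indic (p : nat) (A : {set 'F_p}) (x : 'F_p) : int := (x \in A)%:R.

Lemma sum_indic (p : nat) (A : {set 'F_p}) : \sum_x indic A x = #|A|%:R.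
Proof.
rewrite -sum1_card natr_sum [RHS]big_mkcond; apply: eq_bigr => x _.
by rewrite /indic; case: (x \in A).
Qed.

(** If 1 = a - b in A, then -1 = b - a is a residue too. For p = 2 this would represent 1 twice;
    otherwise a square root of -1 has order 4, which divides p - 1. *)
Lemma perfect_diff_quarter (p : nat) (A : {set 'F_p}) :
  prime p -> perfect_diff A (qres p) -> exists m, p = (4 * m).+1.
Proof.
move=> pr_p [repr diffs].
have oneR : (1 : 'F_p) \in qres p.
  by rewrite inE oner_neq0; apply/existsP; exists 1; rewrite mulr1.
have /eqP/cards1P [[a b] reprE] := repr _ oneR.
have : (a, b) \in [set (a, b)] by rewrite set11.
rewrite -reprE !inE /= => /andP [/andP [aA bA] /eqP ab1].
have a_neq_b : a != b by rewrite -subr_eq0 ab1 oner_neq0.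
have N1R : (-1 : 'F_p) \in qres p by rewrite -ab1 opprB diffs // eq_sym.
have p_gt2 : (2 < p)%N.
  rewrite ltn_neqAle prime_gt1 // andbT; apply/eqP => p2.
  have N1E : (-1 : 'F_p) = 1.
    apply/eqP; rewrite eq_sym -addr_eq0 -(natrD _ 1 1).
    by rewrite -(dvdn_pcharf (pchar_Fp pr_p)) -p2.
  have : (b, a) \in [set (a, b)].
    by rewrite -reprE !inE /= aA bA -opprB ab1 N1E eqxx.
  by rewrite inE => /eqP [ba]; rewrite ba eqxx in a_neq_b.
move: N1R; rewrite inE => /andP [_ /existsP [y /eqP yyN1]].
have [g prim_g] := Fp_primitive_root pr_p.
have y2 : y ^+ 2 = -1 by rewrite expr2.
have y4 : y ^+ 4 = 1 by rewrite (exprM y 2 2) y2 sqrrN expr1n.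
have y_neq0 : y != 0.
  by apply: contra_eq_neq y2 => ->; rewrite expr0n eq_sym oppr_eq0 oner_eq0.
have yp1 := Fp_fermat pr_p y_neq0.
have [k prim_y k_dvd] := prim_order_exists (isT : (0 < 4)%N) y4.
have : (k %| p.-1)%N by rewrite (prim_order_dvd prim_y) yp1.
have : ~~ (k %| 2)%N.
  by rewrite (prim_order_dvd prim_y) y2 eq_sym Fp_neq1N1.
have : k \in divisors 4 by rewrite -dvdn_divisors.
rewrite !inE => /or3P [] /eqP -> // _ /dvdnP [m pE].
by exists m; lia.
Qed.

Section PerfectDifferenceSet.

Variables (p m : nat) (A : {set 'F_p}).
Hypotheses (pr_p : prime p) (pE : p = (4 * m).+1).
Hypothesis A_diff : perfect_diff A (qres p).

Local Notation F := 'F_p.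
Local Notation residue := (@residue p m).
Local Notation nonresidue := (@nonresidue p m).


Lemma conv_indic f t :
  conv (indic A) (fun x => indic A (f x)) t
    = #|[set x in A | f (t - x) \in A]|%:R.
Proof.
rewrite -sum1_card natr_sum [RHS]big_mkcond; apply: eq_bigr => x _.
by rewrite /indic inE -natrM mulnb; case: (_ && _).
Qed.

(** This turns the hypothesis on A into an identity of functions, to be summed or transformed. *)
Lemma conv_indic_diff t :
  conv (indic A) (fun x => indic A (- x)) t = (#|A| * (t == 0))%:R + residue t.
Proof.
have [repr diffs] := A_diff; rewrite conv_indic.
have [->|t_neq0] := eqVneq t 0.
  rewrite muln1 residue0 // addr0; congr (_%:R); apply: eq_card => x.
  by rewrite inE sub0r opprK andbb.
rewrite muln0 add0r /residue -(euler_criterion pr_p pE); congr (_%:R).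
case: (boolP (t \in qres p)) => [tR|tNR].
  apply: etrans (repr t tR).
  rewrite -(card_imset _ (f := fun x => (x, x - t))) => [|x y [] //].
  apply: eq_card => -[x y]; rewrite !inE /=; apply/imsetP/andP.
    move=> [w]; rewrite inE opprB => /andP [wA wtA] [-> ->].
    by rewrite wA wtA subKr.
  move=> [/andP [xA yA] /eqP xyt]; exists x; last by rewrite -xyt subKr.
  by rewrite inE opprB xA -xyt subKr.
apply/eqP; rewrite cards_eq0; apply/eqP/setP => x; rewrite !inE opprB.
apply/negP => /andP [xA xtA]; case/negP: tNR.
rewrite -(subKr x t) diffs // eq_sym -subr_eq0 addrAC subrr add0r.
by rewrite oppr_eq0.
Qed.

Lemma card_perfect_diff : (#|A| * #|A| = #|A| + 2 * m)%N.
Proof.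
suff : (#|A| * #|A|)%:R = (#|A| + 2 * m)%:R :> int.
  by move/eqP; rewrite eqr_nat => /eqP.
have sum_opp : \sum_x indic A (- x) = #|A|%:R.
  by rewrite -sum_indic [RHS](reindex_inj oppr_inj).
have := sum_conv (indic A) (fun x => indic A (- x)).
rewrite sum_opp sum_indic -natrM => <-; under eq_bigr do rewrite conv_indic_diff.
rewrite big_split /= sum_residue // natrD; congr (_ + _).
rewrite (bigD1 0) //= big1 ?addr0 ?muln1 // => x /negPf ->.
by rewrite muln0.
Qed.

(** If x + g y = x' + g y' with x <> x', then x - x' and y - y' are both residues, yet their
    quotient -g is not. *)
Lemma conv_indic_nonresidue g t : g != 0 -> g ^+ (2 * m) = -1 ->
  conv (indic A) (fun x => indic A (x / g)) t = 0 \/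
  conv (indic A) (fun x => indic A (x / g)) t = 1.
Proof.
move=> g_neq0 g1; rewrite (conv_indic (fun x => x / g)).
suff : (#|[set x in A | (t - x) / g \in A]| <= 1)%N.
  by case: #|_| => [|[|]] // _; [left|right].
have [_ diffs] := A_diff.
apply/card_le1_eqP => x y; rewrite !inE => /andP [xA txA] /andP [yA tyA].
apply/eqP/negP => /negP x_neq_y.
rewrite eq_sym in x_neq_y; have := diffs _ _ xA yA x_neq_y.
rewrite (euler_criterion pr_p pE) => /eqP xy1.
have txy : (t - x) / g != (t - y) / g.
  by rewrite (inj_eq (mulIf _)) ?invr_eq0 // (inj_eq (addrI t)) eqr_opp.
have := diffs _ _ txA tyA txy; rewrite (euler_criterion pr_p pE).
have -> : (t - x) / g - (t - y) / g = - 1 * (x - y) / g by ring.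
rewrite !exprMn xy1 expN1_half // exprVn g1 invrN1 !mul1r eq_sym.
by rewrite (negPf (one_neqN1 pr_p pE)).
Qed.

Variables (K : fieldType) (z : K) (q : nat).
Hypotheses (prim_z : p.-primitive_root z) (qK : q \in [pchar K]).
Hypothesis (q_dvd : (q %| m)%N).

Lemma dft_indic_opp u :
  u != 0 ->
  dft z (indic A) u * dft z (indic A) (u * -1) = #|A|%:R + dft z residue u.
Proof.
move=> u_neq0; rewrite dft_scale // ?oppr_eq0 ?oner_eq0 // invrN1.
rewrite (eq_dft z (fun x => congr1 (indic A) (mulrN1 x))).
rewrite (dftM pr_p prim_z) (eq_dft z conv_indic_diff) -dftD; congr (_ + _).
rewrite /dft (bigD1 0) //= big1 => [|x /negPf ->]; last by rewrite muln0 mul0r.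
by rewrite mulr0 addch0 muln1 addr0 mulr1 rmorph_nat.
Qed.

Lemma dft_residue_of_residue u :
  u ^+ (2 * m) = 1 -> dft z residue u = dft z residue 1.
Proof.
move=> u1; have u_neq0 : u != 0.
  by apply/negP => /eqP u0; have := residue0 pr_p pE; rewrite /residue -u0 u1 eqxx.
rewrite -[u in LHS]mul1r dft_scale //; apply: eq_dft => x.
by rewrite mulrC residueM // exprVn u1 invr1.
Qed.

Lemma dft_residue_of_nonresidue u :
  u ^+ (2 * m) = -1 -> dft z residue u = dft z nonresidue 1.
Proof.
move=> u1; have u_neq0 : u != 0.
  apply/negP => /eqP u0; have := nonresidue0 pr_p pE.
  by rewrite /nonresidue -u0 u1 eqxx.
rewrite -[u in LHS]mul1r dft_scale //; apply: eq_dft => x.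
by rewrite mulrC residueMN // exprVn u1 invrN1.
Qed.

(* If q^j = -1 mod p, the q^j-th power map in characteristic q exchanges the
   transform B of A at u and -u, so B(u) B(-u) = 0 forces B(u) = 0. Since the
   product of the two values of B(u) B(-u) is m = 0, B vanishes on a whole
   class of residues, and B(u) B(u g) = 0 for all u <> 0: the number of
   representations x + g y (x, y in A) is constant, though it is at most 1. *)
Lemma negative_power_neq j : (q%:R : F) ^+ j != -1.
Proof.
apply/negP => /eqP qj; have one_neq0 := oner_neq0 F.
have [g g_neq0 g1] := exists_nonresidue pr_p pE.
have B_eq0 u : u != 0 -> #|A|%:R + dft z residue u = 0 -> dft z (indic A) u = 0.
  move=> u_neq0; rewrite -dft_indic_opp // -qj -dft_pcharX // -exprS.
  by move/eqP; rewrite expf_eq0 => /andP [_ /eqP].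
have periods0 : (#|A|%:R + dft z residue 1) * (#|A|%:R + dft z nonresidue 1) = 0.
  have add1 := periods_add pr_p pE prim_z one_neq0.
  have mul1 := periods_mul pr_p pE prim_z one_neq0.
  have cardE : #|A|%:R * #|A|%:R = #|A|%:R + (2%:R * m%:R) :> K.
    by rewrite -!natrM -natrD card_perfect_diff.
  have m0 : m%:R = 0 :> K by apply/eqP; rewrite -(dvdn_pcharf qK).
  have expand (a r s : K) : (a + r) * (a + s) = a * a + a * (r + s) + r * s by ring.
  by rewrite expand cardE add1 mul1 m0; ring.
have B_eq0_or u : u != 0 ->
    dft z (indic A) u = 0 \/ dft z (indic A) (u * g) = 0.
  move=> u_neq0; have ug_neq0 : u * g != 0 by rewrite mulf_neq0.
  move/eqP: periods0; rewrite mulf_eq0 => /orP [] /eqP eta0.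
    case: (expf_half pr_p pE u_neq0) => u1; [left|right]; apply: B_eq0 => //.
      by rewrite dft_residue_of_residue.
    by rewrite dft_residue_of_residue // exprMn u1 g1 mulrNN mulr1.
  case: (expf_half pr_p pE u_neq0) => u1; [right|left]; apply: B_eq0 => //.
    by rewrite dft_residue_of_nonresidue // exprMn u1 g1 mul1r.
  by rewrite dft_residue_of_nonresidue.
pose h := conv (indic A) (fun x => indic A (x / g)).
have sum_h : \sum_t h t = (#|A| * #|A|)%:R.
  rewrite /h sum_conv natrM -sum_indic; congr (_ * _).
  by rewrite [RHS](reindex_inj (mulIf (invr_neq0 g_neq0))).
have h_const t : h t = h 0.
  have h_const_K : (h t)%:~R = (h 0)%:~R :> K.
    apply/(mulfI (natr_p_neq0 pr_p prim_z)).
    rewrite -!(dft_inversion pr_p prim_z); apply: eq_bigr => u _.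
    (* Frequency 0 contributes equally at t and at 0; all other frequencies vanish. *)
    have [->|u_neq0] := eqVneq u 0; first by rewrite !mul0r.
    suff -> : dft z h u = 0 by rewrite !mul0r.
    rewrite -(dftM pr_p prim_z) -dft_scale //.
    by case: (B_eq0_or u u_neq0) => ->; rewrite ?mul0r ?mulr0.
  (* Equality in [K] lifts to the integers because the only values are 0 and 1. *)
  have := oner_neq0 K; move: h_const_K; rewrite /h.
  by case: (conv_indic_nonresidue t g_neq0 g1) => ->;
    case: (conv_indic_nonresidue 0 g_neq0 g1) => -> //;
    rewrite mulr0z mulr1z => ->; rewrite eqxx.
have m_gt0 := quarter_gt0 pr_p pE; have cardE := card_perfect_diff.
move: sum_h; under eq_bigr do rewrite h_const.
rewrite sumr_const (card_Fp pr_p) /h.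
(* With n = |A|, the constant 0 gives n^2 = 0, and the constant 1 gives n^2 = 4m + 1; both
   contradict n^2 = n + 2m with m > 0. *)
case: (conv_indic_nonresidue 0 g_neq0 g1) => -> hE.
  nia.
nia.
Qed.

End PerfectDifferenceSet.

(** * Orders modulo p of the prime divisors of m *)

Lemma expf_odd_part (p r k : nat) (x : 'F_p) :
  prime p -> p.-1 = (r * 2 ^ k)%N -> x != 0 -> (forall j, x ^+ j != -1) ->
  x ^+ r = 1.
Proof.
move=> pr_p pE x_neq0 xN1.
have xp1 := Fp_fermat pr_p x_neq0.
have p1_gt0 : (0 < p.-1)%N by have := prime_gt1 pr_p; lia.
have [d prim_x d_dvd] := prim_order_exists p1_gt0 xp1.
have d_odd : odd d.
  (* For even order d, x^(d/2) is a square root of 1 other than 1, hence the excluded value -1. *)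
  apply/negPn/negP => d_even; pose e := d./2.
  have dE : d = (e * 2)%N by rewrite /e; lia.
  have : x ^+ e ^+ 2 == 1 by rewrite -exprM -dE (prim_expr_order prim_x).
  rewrite sqrf_eq1 (negPf (xN1 e)) orbF -(prim_order_dvd prim_x).
  by have := prim_order_gt0 prim_x => d_gt0 /dvdn_leq; lia.
apply/eqP; rewrite -(prim_order_dvd prim_x).
by rewrite -(@Gauss_dvdl _ _ (2 ^ k)) -?pE // coprimeXr // coprimen2.
Qed.

Lemma natr_expf_eq1 (R : comNzRingType) (r N : nat) :
  (0 < N)%N -> (forall q, prime q -> (q %| N)%N -> q%:R ^+ r = 1 :> R) ->
  N%:R ^+ r = 1 :> R.
Proof.
move=> N_gt0 q1; rewrite (prod_prime_decomp N_gt0) natr_prod -prodrXl.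
rewrite big_seq big1 // => -[q e] /mem_prime_decomp [pr_q e_gt0 qe_dvd] /=.
by rewrite natrX exprAC q1 ?expr1n // (dvdn_trans (dvdn_exp e_gt0 (dvdnn q)) qe_dvd).
Qed.

Section OddQuarter.

Variables (p m : nat) (A : {set 'F_p}).
Hypotheses (pr_p : prime p) (pE : p = (4 * m).+1).
Hypothesis A_diff : perfect_diff A (qres p).

Lemma expf_prime_odd_part (r k q : nat) :
  p.-1 = (r * 2 ^ k)%N -> prime q -> (q %| m)%N -> (q%:R : 'F_p) ^+ r = 1.
Proof.
move=> p1E pr_q q_dvd; have m_gt0 := quarter_gt0 pr_p pE.
have p_neq_q : p != q by apply/eqP => pq; have := dvdn_leq m_gt0 q_dvd; lia.
have [K [z [qK prim_z]]] := exists_prim_root_pchar pr_p pr_q p_neq_q.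
apply: (expf_odd_part pr_p p1E).
  rewrite -(dvdn_pcharf (pchar_Fp pr_p)); apply/negP => /dvdn_leq.
  by have := dvdn_leq m_gt0 q_dvd; have := prime_gt0 pr_q; lia.
exact: (negative_power_neq pr_p pE A_diff prim_z qK q_dvd).
Qed.

(* If m were even, every prime factor of p - 1 = 4 m, including 2, would have
   odd order modulo p, and so would p - 1 = -1. *)
Lemma odd_quarter : odd m.
Proof.
apply/negPn/negP => m_even; have m_gt0 := quarter_gt0 pr_p pE.
have p1_gt0 : (0 < p.-1)%N by lia.
have [r r_odd p1E] := pfactor_coprime (isT : prime 2) p1_gt0.
have : (4 * m)%:R ^+ r = 1 :> 'F_p.
  apply: natr_expf_eq1 => [|q pr_q q_dvd]; first lia.
  apply: (expf_prime_odd_part p1E pr_q).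
  (* The factor 4 brings in no new prime, as m is assumed even. *)
  move: q_dvd; rewrite Euclid_dvdM // => /orP [|//].
  rewrite (@Euclid_dvdX 2 2 q) // andbT dvdn_prime2 // => /eqP ->.
  by rewrite dvdn2.
have -> : (4 * m)%:R = -1 :> 'F_p.
  apply/eqP; rewrite -subr_eq0 opprK natr1 -pE -(dvdn_pcharf (pchar_Fp pr_p)).
  by rewrite dvdnn.
rewrite -signr_odd -coprime2n r_odd expr1 => N11.
by have := one_neqN1 pr_p pE; rewrite N11 eqxx.
Qed.

Lemma expf_prime_quarter q :
  prime q -> (q %| m)%N -> (q%:R : 'F_p) ^+ m = 1.
Proof. by apply: (@expf_prime_odd_part _ 2); rewrite pE /= mulnC. Qed.

End OddQuarter.

(** * Quartic Gauss sums *)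

Lemma eqz_opp (c : int) : c = - c -> c = 0.
Proof. lia. Qed.

Section QuarticPeriods.

Variables (p m : nat).
Hypotheses (pr_p : prime p) (pE : p = (4 * m).+1) (m_odd : odd m).

Local Notation F := 'F_p.

Variable g : F.
Hypotheses (g_neq0 : g != 0) (g_nonres : g ^+ (2 * m) = -1).

Local Notation i := (g ^+ m).

Lemma sqr_i : i * i = -1.
Proof. by rewrite -exprD addnn -mul2n. Qed.

Lemma i_neq0 : i != 0.
Proof. exact: expf_neq0. Qed.

(* [psi0] and [psi1] are the real and imaginary parts of the quartic character
   sending [g] to the imaginary unit, and [chi2] is its square. *)
Definition re (a : F) : int := (a == 1)%:R - (a == -1)%:R.
Definition im (a : F) : int := (a == i)%:R - (a == - i)%:R.
Definition psi0 x := re (x ^+ m).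
Definition psi1 x := im (x ^+ m).
Definition chi2 x := re (x ^+ (2 * m)).

Lemma reN a : re (- a) = - re a.
Proof. by rewrite /re opprB eqr_opp eqr_oppLR. Qed.

Lemma imN a : im (- a) = - im a.
Proof. by rewrite /im opprB eqr_opp eqr_oppLR. Qed.

Lemma re_iM a : re (i * a) = - im a.
Proof.
have eqN1 : (i * a == -1) = (a == i).
  by rewrite -sqr_i (inj_eq (mulfI i_neq0)).
have eq1 : (i * a == 1) = (a == - i).
  by rewrite -[1]opprK -sqr_i -mulrN (inj_eq (mulfI i_neq0)).
by rewrite /re /im opprB eqN1 eq1.
Qed.

Lemma im_iM a : im (i * a) = re a.
Proof.
have eqi : (i * a == i) = (a == 1).
  by rewrite -{2}[i]mulr1 (inj_eq (mulfI i_neq0)).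
have eqNi : (i * a == - i) = (a == -1).
  by rewrite -{2}[i]mulr1 -mulrN (inj_eq (mulfI i_neq0)).
by rewrite /re /im eqi eqNi.
Qed.

Lemma re1 : re 1 = 1.
Proof. by rewrite /re eqxx (negPf (one_neqN1 pr_p pE)). Qed.

Lemma im1 : im 1 = 0.
Proof.
have neq (b : F) : b * b = -1 -> (1 == b) = false.
  move=> bb; apply/negP => /eqP b1; have := one_neqN1 pr_p pE.
  by rewrite -bb -b1 mulr1 eqxx.
by rewrite /im !neq // ?mulrNN sqr_i.
Qed.

(** The cases are t^m = 1, -1, i, -i: [psi0] and [psi1] are rotated together by a multiple of a
    quarter turn, and [chi2] is multiplied by the square of that rotation. *)
Variant quartic_spec (t : F) : Prop :=
| Quartic1 of (forall x, psi0 (t * x) = psi0 x)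
    & (forall x, psi1 (t * x) = psi1 x) & (forall x, chi2 (t * x) = chi2 x)
| QuarticN1 of (forall x, psi0 (t * x) = - psi0 x)
    & (forall x, psi1 (t * x) = - psi1 x) & (forall x, chi2 (t * x) = chi2 x)
| QuarticI of (forall x, psi0 (t * x) = - psi1 x)
    & (forall x, psi1 (t * x) = psi0 x) & (forall x, chi2 (t * x) = - chi2 x)
| QuarticNI of (forall x, psi0 (t * x) = psi1 x)
    & (forall x, psi1 (t * x) = - psi0 x) & (forall x, chi2 (t * x) = - chi2 x).

Lemma quarticP t : t != 0 -> quartic_spec t.
Proof.
move=> t_neq0.
have chi2E x : chi2 (t * x) = re (t ^+ m * t ^+ m * x ^+ (2 * m)).
  by rewrite /chi2 exprMn -exprD addnn -mul2n.
have : (t ^+ m - 1) * (t ^+ m + 1) * (t ^+ m - i) * (t ^+ m + i) = 0.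
  (* The factorisation of X^4 - 1 at X = t^m, with the correction that vanishes because i^2 = -1. *)
  have -> : (t ^+ m - 1) * (t ^+ m + 1) * (t ^+ m - i) * (t ^+ m + i)
          = t ^+ m ^+ 4 - 1 - (i * i + 1) * (t ^+ m ^+ 2 - 1) by ring.
  by rewrite sqr_i addNr mul0r subr0 -exprM mulnC expf_Fp ?subrr.
move/eqP; rewrite !mulf_eq0 -!orbA !subr_eq0 !addr_eq0.
case/or4P => /eqP tm;
  [apply: Quartic1|apply: QuarticN1|apply: QuarticI|apply: QuarticNI] => x;
  rewrite ?chi2E /psi0 /psi1 ?exprMn tm ?mul1r ?mulN1r ?mulNr ?mulrN
    ?sqr_i ?mulN1r ?opprK ?mul1r ?mulNr ?reN ?imN ?re_iM ?im_iM ?reN ?opprK //.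
Qed.

(** Here m odd matters: (-1)^m = -1, so the quartic character is odd. *)
Lemma psi0N x : psi0 (- x) = - psi0 x.
Proof. by rewrite /psi0 exprNn -signr_odd m_odd expr1 mulN1r reN. Qed.

Lemma psi1N x : psi1 (- x) = - psi1 x.
Proof. by rewrite /psi1 exprNn -signr_odd m_odd expr1 mulN1r imN. Qed.

Lemma chi2N x : chi2 (- x) = chi2 x.
Proof. by rewrite /chi2 mul2n -muln2 mulnC exprM sqrrN -exprM. Qed.

Lemma chi2_gM x : chi2 (g * x) = - chi2 x.
Proof. by rewrite /chi2 exprMn g_nonres mulN1r reN. Qed.

Lemma chi2_0 : chi2 0 = 0.
Proof. by apply: eqz_opp; rewrite -[in LHS](mulr0 g) chi2_gM. Qed.

Lemma chi2_1 : chi2 1 = 1.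
Proof. by rewrite /chi2 expr1n re1. Qed.

Lemma psi0_0 : psi0 0 = 0.
Proof. by apply: eqz_opp; rewrite -[in LHS]oppr0 psi0N. Qed.

Lemma psi1_0 : psi1 0 = 0.
Proof. by apply: eqz_opp; rewrite -[in LHS]oppr0 psi1N. Qed.

Lemma quartic_values t : t != 0 ->
  [/\ psi0 t * psi0 t + psi1 t * psi1 t = 1, chi2 t = 1 \/ chi2 t = -1
    & chi2 t * chi2 t = 1].
Proof.
move=> t_neq0; have psi0_1 : psi0 1 = 1 by rewrite /psi0 expr1n re1.
have psi1_1 : psi1 1 = 0 by rewrite /psi1 expr1n im1.
rewrite -[t]mulr1; case: (quarticP t_neq0) => -> -> ->;
  by rewrite psi0_1 psi1_1 chi2_1; split=> //; first [by left | by right].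
Qed.

Lemma chi2M t x : t != 0 -> chi2 (t * x) = chi2 t * chi2 x.
Proof.
move=> t_neq0; rewrite -{2}[t]mulr1.
by case: (quarticP t_neq0) => _ _ c2; rewrite !c2 chi2_1 ?mulN1r ?mul1r.
Qed.

Lemma sum_anti (f : F -> int) t :
  t != 0 -> (forall x, f (t * x) = - f x) -> \sum_x f x = 0.
Proof.
move=> t_neq0 fN.
apply: eqz_opp; rewrite [LHS](reindex_inj (mulfI t_neq0)) -sumrN.
by apply: eq_bigr => x _; rewrite fN.
Qed.

Lemma sum_psi0 : \sum_x psi0 x = 0.
Proof.
apply: (@sum_anti _ (-1)); first by rewrite oppr_eq0 oner_eq0.
by move=> x; rewrite mulN1r psi0N.
Qed.

Lemma sum_psi1 : \sum_x psi1 x = 0.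
Proof.
apply: (@sum_anti _ (-1)); first by rewrite oppr_eq0 oner_eq0.
by move=> x; rewrite mulN1r psi1N.
Qed.

Lemma sum_chi2 : \sum_x chi2 x = 0.
Proof. exact: sum_anti g_neq0 chi2_gM. Qed.

Lemma sum_const_off0 (h : F -> int) :
  (forall t, t != 0 -> h t = h 1) -> \sum_t h t = h 0 + (4 * m)%:R * h 1.
Proof.
move=> h_inv; rewrite (bigD1 0) //=.
under eq_bigr => t t_neq0 do rewrite h_inv //.
by rewrite sumr_const (cardC1 0) card_Fp // (predpE pE) mulr_natl.
Qed.

(** For psi = psi0 + i psi1, [re_conv] and twice [im_conv] are the real and imaginary parts of the
    convolution of psi with itself; at 1 they give the quartic Jacobi sum. *)
Definition norm_conv t := conv psi0 psi0 t + conv psi1 psi1 t.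
Definition re_conv t := conv psi0 psi0 t - conv psi1 psi1 t.
Definition im_conv := conv psi0 psi1.

Lemma conv_scale (f f' : F -> int) t x : t != 0 ->
  conv f f' (t * x) = conv (fun y => f (t * y)) (fun y => f' (t * y)) x.
Proof.
move=> t_neq0; rewrite /conv (reindex_inj (mulfI t_neq0)).
by apply: eq_bigr => y _; rewrite mulrBr.
Qed.

Lemma norm_convM t x : t != 0 -> norm_conv (t * x) = norm_conv x.
Proof.
move=> t_neq0; rewrite /norm_conv !conv_scale // /conv -!big_split /=.
by apply: eq_bigr => y _; case: (quarticP t_neq0) => p0 p1 _; rewrite !p0 !p1; ring.
Qed.

Lemma re_convM t x : t != 0 -> re_conv (t * x) = chi2 t * re_conv x.
Proof.
move=> t_neq0; rewrite /re_conv !conv_scale // /conv -!sumrB mulr_sumr.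
rewrite -[in chi2 t](mulr1 t); apply: eq_bigr => y _.
by case: (quarticP t_neq0) => p0 p1 c2; rewrite !p0 !p1 !c2 chi2_1; ring.
Qed.

Lemma convC (f f' : F -> int) : conv f f' =1 conv f' f.
Proof.
move=> t; rewrite /conv (reindex_inj (subrI t)).
by apply: eq_bigr => x _; rewrite subKr mulrC.
Qed.

Lemma im_convM t x : t != 0 -> im_conv (t * x) = chi2 t * im_conv x.
Proof.
move=> t_neq0.
(* A quarter turn exchanges the roles of [psi0] and [psi1], so only the symmetrised integrand
   transforms termwise. *)
suff : 2 * im_conv (t * x) = chi2 t * (2 * im_conv x).
  by case: (quartic_values t_neq0) => _ [] -> _; lia.
have twice y : 2 * im_conv y = conv psi0 psi1 y + conv psi1 psi0 y.
  by rewrite /im_conv [conv psi1 _ _]convC; ring.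
rewrite !twice !conv_scale // /conv -!big_split mulr_sumr /=.
rewrite -[in chi2 t](mulr1 t); apply: eq_bigr => y _.
by case: (quarticP t_neq0) => p0 p1 c2; rewrite !p0 !p1 !c2 chi2_1; ring.
Qed.

(** Off 0 this is scaling from 1; at 0, scaling by the nonresidue g shows the value equals its
    opposite. *)
Lemma re_convE t : re_conv t = re_conv 1 * chi2 t.
Proof.
have [->|t_neq0] := eqVneq t 0; last by rewrite -{1}[t]mulr1 re_convM // mulrC.
rewrite chi2_0 mulr0; apply: eqz_opp.
by rewrite -[in LHS](mulr0 g) re_convM // -[g]mulr1 chi2_gM chi2_1 mulN1r.
Qed.

Lemma im_convE t : im_conv t = im_conv 1 * chi2 t.
Proof.
have [->|t_neq0] := eqVneq t 0; last by rewrite -{1}[t]mulr1 im_convM // mulrC.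
rewrite chi2_0 mulr0; apply: eqz_opp.
by rewrite -[in LHS](mulr0 g) im_convM // -[g]mulr1 chi2_gM chi2_1 mulN1r.
Qed.

Lemma norm_conv_inv t : t != 0 -> norm_conv t = norm_conv 1.
Proof. by move=> t_neq0; rewrite -{1}[t]mulr1 norm_convM. Qed.

Lemma norm_conv0 : norm_conv 0 = - (4 * m)%:R.
Proof.
rewrite /norm_conv /conv -big_split (bigD1 0) //= psi0_0 psi1_0 !mul0r add0r.
under eq_bigr => x x_neq0.
  have [E _ _] := quartic_values x_neq0.
  have -> : psi0 x * psi0 (0 - x) + psi1 x * psi1 (0 - x) = -1.
    by rewrite !sub0r psi0N psi1N !mulrN -opprD E.
over.
by rewrite sumr_const (cardC1 0) card_Fp // (predpE pE) mulNrn.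
Qed.

(** The total is 0, since [psi0] and [psi1] have sum 0, and the value -4m at 0 is balanced by 4m
    equal values. *)
Lemma norm_conv1 : norm_conv 1 = 1.
Proof.
have := sum_const_off0 norm_conv_inv.
rewrite norm_conv0 big_split /= !sum_conv // sum_psi0 sum_psi1 !mul0r.
have := quarter_gt0 pr_p pE; nia.
Qed.

Lemma chi2_conv_inv t : t != 0 -> conv chi2 chi2 t = conv chi2 chi2 1.
Proof.
move=> t_neq0; rewrite -{1}[t]mulr1 conv_scale //; apply: eq_bigr => x _.
have [_ _ t2] := quartic_values t_neq0.
by rewrite !(chi2M _ t_neq0) mulrACA t2 mul1r.
Qed.

Lemma chi2_conv0 : conv chi2 chi2 0 = (4 * m)%:R.
Proof.
rewrite /conv (bigD1 0) //= chi2_0 mul0r add0r.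
under eq_bigr => x x_neq0.
  have [_ _ E] := quartic_values x_neq0; rewrite sub0r chi2N E.
over.
by rewrite sumr_const (cardC1 0) card_Fp // (predpE pE).
Qed.

Lemma chi2_conv1 : conv chi2 chi2 1 = -1.
Proof.
have := sum_const_off0 chi2_conv_inv.
rewrite chi2_conv0 sum_conv // sum_chi2 mul0r.
have := quarter_gt0 pr_p pE; nia.
Qed.

Section GaussSums.

Variables (K : fieldType) (z : K).
Hypothesis prim_z : p.-primitive_root z.

Local Notation theta0 := (dft z psi0 1).
Local Notation theta1 := (dft z psi1 1).
Local Notation gauss := (dft z chi2 1).

Lemma sqr_gauss : gauss * gauss = p%:R.
Proof.
rewrite (dftM pr_p prim_z) (dft_invariant pr_p prim_z chi2_conv_inv) ?oner_neq0 //.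
by rewrite chi2_conv0 chi2_conv1 opprK pE -natr1 rmorphD /= rmorph_nat.
Qed.

Lemma theta_add : theta0 * theta0 + theta1 * theta1 = - p%:R.
Proof.
rewrite !(dftM pr_p prim_z) dftD.
rewrite (dft_invariant pr_p prim_z norm_conv_inv) ?oner_neq0 //.
by rewrite norm_conv0 norm_conv1 pE -opprD natr1 rmorphN /= rmorph_nat.
Qed.

Lemma theta_sub : theta0 * theta0 - theta1 * theta1 = (re_conv 1)%:~R * gauss.
Proof.
by rewrite !(dftM pr_p prim_z) dftB -dftZ; apply: eq_dft re_convE _.
Qed.

Lemma theta_mul : theta0 * theta1 = (im_conv 1)%:~R * gauss.
Proof.
by rewrite !(dftM pr_p prim_z) -dftZ; apply: eq_dft im_convE _.
Qed.

(* Expand (theta0^2 + theta1^2)^2 = (theta0^2 - theta1^2)^2 + 4 (theta0 theta1)^2. *)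
Lemma two_squares_K :
  ((re_conv 1 ^+ 2 + 4 * im_conv 1 ^+ 2)%:~R : K) = p%:R.
Proof.
apply/(mulfI (natr_p_neq0 pr_p prim_z)).
transitivity ((theta0 * theta0 + theta1 * theta1) ^+ 2); last first.
  by rewrite theta_add sqrrN.
have -> : (theta0 * theta0 + theta1 * theta1) ^+ 2
    = (theta0 * theta0 - theta1 * theta1) ^+ 2 + 4 * (theta0 * theta1) ^+ 2 by ring.
rewrite theta_sub theta_mul -sqr_gauss !exprMn rmorphD rmorphM !rmorphXn /=.
by ring.
Qed.

End GaussSums.

(** Both sides are integers, so the identity may be read off in characteristic 0. *)
Lemma two_squares : re_conv 1 ^+ 2 + 4 * im_conv 1 ^+ 2 = p%:Z.
Proof.
have [z prim_z] := C_prim_root_exists (prime_gt0 pr_p).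
by apply/(@intr_inj algC); rewrite (two_squares_K prim_z).
Qed.

End QuarticPeriods.

(** * Residues modulo 8 *)

Section SquareRootsInCharacteristic.

Variables (q : nat) (K : closedFieldType) (w : K).
Hypotheses (pr_q : prime q) (q_odd : odd q) (qK : q \in [pchar K]).
Hypothesis w_fixed : w ^+ q = w.

Lemma eq_oppK_eq0 (v : K) : v = - v -> v = 0.
Proof.
move/eqP; rewrite -addr_eq0 -mulr2n -mulr_natl mulf_eq0 -(dvdn_pcharf qK).
by rewrite dvdn_prime2 // => /orP [/eqP q2|/eqP //]; move: q_odd; rewrite q2.
Qed.

(** For q = 3 mod 4, w^q = w^3 = -w would differ from w. *)
Lemma modn4_of_sqrtN1 : w * w = -1 -> (q %% 4 = 1)%N.
Proof.
move=> ww; have [//|q3] : (q %% 4 = 1 \/ q %% 4 = 3)%N by lia.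
have : w = - w.
  rewrite -[LHS]w_fixed (divn_eq q 4) q3 addnC exprD mulnC exprM.
  have w2 : w ^+ 2 = -1 by rewrite expr2.
  have -> : w ^+ 4 = 1 by rewrite (exprM w 2 2) w2 sqrrN expr1n.
  by rewrite expr1n mulr1 exprS w2 mulrN1.
move=> /eq_oppK_eq0 w0; have := oner_neq0 K.
by rewrite -[1]opprK -ww w0 mulr0 oppr0 eqxx.
Qed.

(** For q = 5 or 7 mod 8, Frobenius negates e + e^3, where e^4 = -1; but this equals w or -w, which
    Frobenius fixes. *)
Lemma modn8_of_sqrtN2 : w * w = -2 -> (q %% 8 = 1 \/ q %% 8 = 3)%N.
Proof.
move=> ww; have two_neq0 : 2 != 0 :> K.
  apply/negP => /eqP two0; have := oner_neq0 K.
  rewrite (@eq_oppK_eq0 1) ?eqxx //; apply/eqP.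
  by rewrite -addr_eq0 -mulr2n two0.
suff : ~ (q %% 8 = 5 \/ q %% 8 = 7)%N by lia.
move=> q57.
have /closed_rootP [e] : size ('X^4 - (-1)%:P : {poly K}) != 1%N.
  by rewrite size_XnsubC.
rewrite /root !hornerE subr_eq0 => /eqP e4.
(* [e] is a primitive eighth root of unity, so [v] plays the role of [sqrt (-2)]. *)
pose v := e + e ^+ 3.
have vv : v * v = -2.
  have -> : v * v = e ^+ 2 + 2 * e ^+ 4 + e ^+ 4 * e ^+ 2 by rewrite /v; ring.
  by rewrite e4; ring.
have e8 : e ^+ 8 = 1 by rewrite (exprM e 4 2) e4 sqrrN expr1n.
have vN : v ^+ q = - v.
  rewrite -(pFrobenius_autE qK) rmorphD rmorphXn /= pFrobenius_autE.
  rewrite (divn_eq q 8) addnC exprD mulnC exprM e8 expr1n mulr1.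
  have e5 : e ^+ 5 = - e by rewrite exprSr e4 mulN1r.
  have e7 : e ^+ 7 = - e ^+ 3 by rewrite (exprD e 4 3) e4 mulN1r.
  case: q57 => ->; rewrite /v ?e5 ?e7; first by ring.
  have -> : (- e ^+ 3) ^+ 3 = - (e ^+ 8 * e) by ring.
  by rewrite e8; ring.
have vv_fixed : v ^+ q = v.
  have : (v - w) * (v + w) = 0 by rewrite -subr_sqr !expr2 vv ww subrr.
  move/eqP; rewrite mulf_eq0 subr_eq0 addr_eq0 => /orP [] /eqP -> //.
  by rewrite exprNn -signr_odd q_odd expr1 mulN1r w_fixed.
have v0 : v = 0 by apply: eq_oppK_eq0; rewrite -vN vv_fixed.
by move/eqP: vv; rewrite v0 mulr0 eq_sym oppr_eq0 (negPf two_neq0).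
Qed.

End SquareRootsInCharacteristic.

(** * Prime divisors of the two components of the Jacobi sum *)

Section QuarticObstruction.

Variables (p m q : nat) (g : 'F_p).
Hypotheses (pr_p : prime p) (pE : p = (4 * m).+1) (m_odd : odd m).
Hypotheses (g_neq0 : g != 0) (g_nonres : g ^+ (2 * m) = -1).
Hypotheses (pr_q : prime q) (q_odd : odd q) (p_neq_q : p != q).
Hypothesis q_quartic : (q%:R : 'F_p) ^+ m = 1.

(** Frobenius moves the frequency from 1 to q, and scaling by q does not affect f because q^m = 1
    modulo p. *)
Lemma dft_quartic_fixed (K : fieldType) (z : K) (f : 'F_p -> int) :
  p.-primitive_root z -> q \in [pchar K] ->
  (forall x t, t ^+ m = 1 -> f (x * t) = f x) -> dft z f 1 ^+ q = dft z f 1.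
Proof.
move=> prim_z qK f_inv; rewrite (dft_pchar pr_p prim_z) // dft_scale.
  by apply: eq_dft => x; rewrite f_inv // exprVn q_quartic invr1.
rewrite -(dvdn_pcharf (pchar_Fp pr_p)) dvdn_prime2 //.
Qed.

Lemma psi0_fixed (x t : 'F_p) : t ^+ m = 1 -> psi0 m (x * t) = psi0 m x.
Proof. by move=> t1; rewrite /psi0 exprMn t1 mulr1. Qed.

Lemma psi1_fixed (x t : 'F_p) : t ^+ m = 1 -> psi1 m g (x * t) = psi1 m g x.
Proof. by move=> t1; rewrite /psi1 exprMn t1 mulr1. Qed.

Lemma chi2_fixed (x t : 'F_p) : t ^+ m = 1 -> chi2 m (x * t) = chi2 m x.
Proof. by move=> t1; rewrite /chi2 exprMn mulnC (exprM t) t1 expr1n mulr1. Qed.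

Lemma intr_dvd_eq0 (K : fieldType) (c : int) :
  q \in [pchar K] -> (q %| `|c|)%N -> c%:~R = 0 :> K.
Proof.
move=> qK /dvdnP [k cE]; rewrite [c]intEsign cE rmorphM /= -pmulrn natrM.
by rewrite (pcharf0 qK) !mulr0.
Qed.

Lemma modn4_of_dvd_im_conv : (q %| `|im_conv m g 1%R|)%N -> (q %% 4 = 1)%N.
Proof.
move=> q_dvd; have [K [z [qK prim_z]]] := exists_prim_root_pchar pr_p pr_q p_neq_q.
have s2 := sqr_gauss pr_p pE m_odd g_neq0 g_nonres prim_z.
have s_fixed := dft_quartic_fixed prim_z qK chi2_fixed.
have t0_fixed := dft_quartic_fixed prim_z qK psi0_fixed.
have t1_fixed := dft_quartic_fixed prim_z qK psi1_fixed.
have tD := theta_add pr_p pE m_odd g_neq0 g_nonres prim_z.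
have := theta_mul pr_p pE m_odd g_neq0 g_nonres prim_z.
rewrite (intr_dvd_eq0 qK q_dvd) mul0r; move/eqP.
have := natr_p_neq0 pr_p prim_z; move: tD; rewrite -s2.
move: (dft z (chi2 m) 1) (dft z (psi0 m) 1) (dft z (psi1 m g) 1)
  s_fixed t0_fixed t1_fixed => s t0 t1 sq t0q t1q tD.
rewrite mulf_eq0 orbb => s_neq0 t01.
have sqrt_case t : t ^+ q = t -> t * t = - (s * s) -> (q %% 4 = 1)%N.
  move=> tq tt; apply: (@modn4_of_sqrtN1 q K (t / s)) => //.
    by rewrite exprMn exprVn tq sq.
  by rewrite mulrACA tt -invfM mulNr divff // mulf_neq0.
move: t01; rewrite mulf_eq0 => /orP [] /eqP t0E.
  by apply: (sqrt_case t1) => //; rewrite -tD t0E mul0r add0r.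
by apply: (sqrt_case t0) => //; rewrite -tD t0E mul0r addr0.
Qed.

Lemma modn8_of_dvd_re_conv :
  (q %| `|re_conv m g 1%R|)%N -> (q %% 8 = 1 \/ q %% 8 = 3)%N.
Proof.
move=> q_dvd; have [K [z [qK prim_z]]] := exists_prim_root_pchar pr_p pr_q p_neq_q.
have s2 := sqr_gauss pr_p pE m_odd g_neq0 g_nonres prim_z.
have s_fixed := dft_quartic_fixed prim_z qK chi2_fixed.
have t0_fixed := dft_quartic_fixed prim_z qK psi0_fixed.
have tD := theta_add pr_p pE m_odd g_neq0 g_nonres prim_z.
have := theta_sub pr_p pE g_neq0 g_nonres prim_z.
rewrite (intr_dvd_eq0 qK q_dvd) mul0r; move/eqP; rewrite subr_eq0 => /eqP t01.
have := natr_p_neq0 pr_p prim_z; move: tD; rewrite -t01 -s2.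
move: (dft z (chi2 m) 1) (dft z (psi0 m) 1) s_fixed t0_fixed
  => s t0 sq t0q tD.
rewrite mulf_eq0 orbb => s_neq0.
(* Here 2 t0^2 = -s^2 with s nonzero, so s / t0 exists and squares to -2. *)
have t0_neq0 : t0 != 0.
  apply: contra_eq_neq tD => ->; rewrite mulr0 addr0 eq_sym oppr_eq0.
  by rewrite mulf_neq0.
apply: (@modn8_of_sqrtN2 q K (s / t0)) => //.
  by rewrite exprMn exprVn t0q sq.
have ss : s * s = -2 * (t0 * t0) by rewrite -[s * s]opprK -tD; ring.
by rewrite mulrACA ss -invfM mulfK // mulf_neq0.
Qed.

End QuarticObstruction.

(** Compose the representations in two ways: p^2 = (ac + bd)^2 + (ad - bc)^2 = (ac - bd)^2 + (ad +
    bc)^2. In one of them p divides the second base, while the first is odd, hence nonzero; so the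
    second is 0. *)
Lemma sum_two_squares_uniq (p a b c d : nat) :
  prime p -> p = (a * a + b * b)%N -> p = (c * c + d * d)%N ->
  odd a -> ~~ odd b -> odd c -> a = c /\ b = d.
Proof.
move=> pr_p abE cdE a_odd b_even c_odd.
have d_even : ~~ odd d.
  have : odd p by rewrite abE oddD !oddM a_odd (negPf b_even).
  by rewrite cdE oddD !oddM c_odd /= andbb.
have p_gt0 := prime_gt0 pr_p.
suff ad_bc : (a * d * (a * d) = b * c * (b * c))%N.
  (* Expand p as c^2 + d^2 on the left and as a^2 + b^2 on the right. *)
  have aacc : (a * a * p = c * c * p)%N.
    rewrite {1}cdE abE !mulnDr [(c * c * (a * a))%N]mulnC; congr (_ + _)%N.
    by rewrite mulnACA ad_bc mulnACA mulnC.
  have sqr_inj (x y : nat) : (x * x = y * y)%N -> x = y.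
    by move/eqP; rewrite !mulnn eqn_exp2r // => /eqP.
  have ac : (a * a = c * c)%N by apply/eqP; rewrite -(eqn_pmul2r p_gt0) aacc.
  by split; apply: sqr_inj => //; apply/(@addnI (a * a)%N); rewrite -abE ac.
pose X := (a * c)%N; pose Y := (b * d)%N; pose U := (a * d)%N; pose V := (b * c)%N.
have X_odd : odd X by rewrite oddM a_odd c_odd.
have Y_even : ~~ odd Y by rewrite oddM (negPf b_even).
have pp_add : (p%:Z * p%:Z = (X%:Z + Y%:Z) ^+ 2 + (U%:Z - V%:Z) ^+ 2)%R.
  by rewrite {1}abE cdE /X /Y /U /V !PoszD !PoszM; ring.
have pp_sub : (p%:Z * p%:Z = (X%:Z - Y%:Z) ^+ 2 + (U%:Z + V%:Z) ^+ 2)%R.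
  by rewrite {1}abE cdE /X /Y /U /V !PoszD !PoszM; ring.
have multiple_eq0 (k s : int) :
    p%:Z * p%:Z = s ^+ 2 + (k * p%:Z) ^+ 2 -> s != 0 -> k = 0.
  move=> ppE s_neq0; apply: contra_eq ppE => k_neq0; apply/negP => /eqP ppE.
  have s_gt0 : 0 < s ^+ 2 by rewrite exprn_even_gt0 // s_neq0.
  have : p%:Z * p%:Z <= (k * p%:Z) ^+ 2.
    rewrite exprMn !expr2 ler_peMl //.
    by rewrite -expr2 -gtz0_ge1 exprn_even_gt0 // k_neq0.
  by rewrite ppE; lia.
have : (p%:Z %| (U%:Z - V%:Z) * (U%:Z + V%:Z))%Z.
  (* Indeed a^2 d^2 - b^2 c^2 = a^2 (p - c^2) - (p - a^2) c^2. *)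
  apply/dvdzP; exists (a%:Z * a%:Z - c%:Z * c%:Z).
  by rewrite [RHS]mulrBl {1}cdE abE /U /V !PoszD !PoszM; ring.
rewrite dvdzE abszM Euclid_dvdM // -!dvdzE => /orP [] /dvdzP [k kE].
  have XY_neq0 : X%:Z + Y%:Z != 0 by apply/eqP; lia.
  have k0 : k = 0 by apply: (multiple_eq0 _ _ _ XY_neq0); rewrite -kE.
  have UV : U = V by move: kE; rewrite k0; lia.
  by rewrite -/U -/V UV.
have XY_neq0 : X%:Z - Y%:Z != 0.
  by apply/eqP => XY; have XYE : X = Y by [lia]; rewrite XYE (negPf Y_even) in X_odd.
have k0 : k = 0 by apply: (multiple_eq0 _ _ _ XY_neq0); rewrite -kE.
have [U0 V0] : U = 0%N /\ V = 0%N by move: kE; rewrite k0; lia.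
by rewrite -/U -/V U0 V0.
Qed.

Local Close Scope ring_scope.

Theorem theorem5 (p : nat) (A : {set 'F_p}) :
  prime p -> perfect_diff A (qres p) ->
  let n := #|A| in
  (forall q, prime q -> (q %| n)%N -> q %% 8 <> 7) /\
  (forall q, prime q -> (q %| n.-1)%N -> q %% 8 <> 7) /\
  (forall q, prime q -> (q %| (if odd n then n else n.-1))%N -> q %% 8 <> 5) /\
  (forall q, prime q -> (q %| (if odd n then n.-1 else n))%N -> q %% 8 <> 3).
Proof.
move=> pr_p A_diff n; have [m pE] := perfect_diff_quarter pr_p A_diff.
have m_gt0 := quarter_gt0 pr_p pE; have m_odd := odd_quarter pr_p pE A_diff.
have cardE : (n * n = n + 2 * m)%N := card_perfect_diff pr_p pE A_diff.
have [g g_neq0 g_nonres] := exists_nonresidue pr_p pE.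
(* The odd and the even one of n, n - 1, to be matched with the components of the Jacobi sum. *)
pose a := (if odd n then n else n.-1)%N; pose b := (if odd n then n.-1 else n)%N.
have n_gt1 : (1 < n)%N by nia.
have ab2m : (a * b = 2 * m)%N by rewrite /a /b; case: ifP => _; nia.
have pab : p = (a * a + b * b)%N by rewrite /a /b; case: ifP => _; nia.
have a_odd : odd a by rewrite /a; case: ifP => //; lia.
have b_even : ~~ odd b by rewrite /b; case: ifP => //; lia.
pose c := `|re_conv m g 1%R|%N; pose d := (2 * `|im_conv m g 1%R|)%N.
have pcd : p = (c * c + d * d)%N.
  have := two_squares pr_p pE m_odd g_neq0 g_nonres; rewrite /c /d; nia.
have c_odd : odd c.
  have : odd p by rewrite pab oddD !oddM a_odd (negPf b_even).
  by rewrite pcd oddD !oddM /= andbb addbF.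
have [ac bd] := sum_two_squares_uniq pr_p pab pcd a_odd b_even c_odd.
(* As ab = 2m, an odd prime divisor of ab divides m, hence is smaller than p. *)
have obstruction q : prime q -> odd q -> (q %| a * b)%N ->
    [/\ p != q & ((q%:R : 'F_p) ^+ m = 1)%R].
  move=> pr_q q_odd; rewrite ab2m Euclid_dvdM // dvdn_prime2 //.
  case/orP => [/eqP q2|q_dvd]; first by rewrite q2 in q_odd.
  split; last exact: expf_prime_quarter pr_p pE A_diff _ pr_q q_dvd.
  by apply/eqP => pq; have := dvdn_leq m_gt0 q_dvd; lia.
have mod_a q : prime q -> odd q -> (q %| a)%N -> (q %% 8 = 1 \/ q %% 8 = 3)%N.
  move=> pr_q q_odd q_dvd.
  have [p_neq_q q1] := obstruction q pr_q q_odd (dvdn_mulr _ q_dvd).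
  rewrite ac in q_dvd.
  exact: modn8_of_dvd_re_conv q_dvd.
have mod_b q : prime q -> odd q -> (q %| b)%N -> (q %% 4 = 1)%N.
  move=> pr_q q_odd q_dvd.
  have [p_neq_q q1] := obstruction q pr_q q_odd (dvdn_mull _ q_dvd).
  move: q_dvd; rewrite bd Euclid_dvdM // dvdn_prime2 //.
  case/orP => [/eqP q2|q_dvd]; first by rewrite q2 in q_odd.
  exact: modn4_of_dvd_im_conv q_dvd.
have mod7 q : prime q -> (q %| a)%N || (q %| b)%N -> q %% 8 <> 7.
  move=> pr_q q_dvd q7; have q_odd : odd q by lia.
  by case/orP: q_dvd => [/(mod_a q pr_q q_odd)|/(mod_b q pr_q q_odd)]; lia.
split.
  move=> q pr_q q_dvd; apply: mod7 => //.
  by rewrite /a /b; case: ifP; rewrite q_dvd ?orbT.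
split.
  move=> q pr_q q_dvd; apply: mod7 => //.
  by rewrite /a /b; case: ifP; rewrite q_dvd ?orbT.
split=> q pr_q q_dvd q_mod; have q_odd : odd q by lia.
  by have := mod_a q pr_q q_odd q_dvd; lia.
by have := mod_b q pr_q q_odd q_dvd; lia.
Qed.
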